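(* Let $p$ be a prime, $a\ge 1$, $R=\mathbb{Z}/p^a\mathbb{Z}$, and let $\xi$ be a probability distribution on $R$ that is not concentrated on an affine translate of a proper subring of $R$. For every $\epsilon>0$ there is a constant $C(a,\xi,\epsilon)$, depending only on $p,a,\xi,\epsilon$ (and not on $N$, $k$ or $f$), such that for all $N\ge1$ and $k\ge 1$ the following holds. Let $\mathcal{M}_1,\dots,\mathcal{M}_k$ be independent random $N\times N$ matrices over $R$ whose entries are independent with distribution $\xi$, and let $\mathcal{U}_1,\dots,\mathcal{U}_k$ be independent, uniformly random $N\times N$ matrices over $R$. Let $f$ be any function (with values in any set) on $N\times N$ matrices over $R$ that is invariant under the right action of $SL_N(\mathbb{Z}/p^a\mathbb{Z})$, i.e. $f(Ag)=f(A)$ for all $A\in \mathrm{Mat}_{N,N}(R)$ and $g\in SL_N(R)$. Then $$d_{TV}\big(f(\mathcal{M}_1\mathcal{M}_2\cdots\mathcal{M}_k),\ f(\mathcal{U}_1\mathcal{U}_2\cdots\mathcal{U}_k)\big)<k\,C(a,\xi,\epsilon)\,e^{\epsilon N}\,\big(\|\xi \bmod p\|_{2}\big)^{N}.$$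
   Context: $d_{TV}(X,Y)$ denotes the total variation distance between the distributions of the random variables $X$ and $Y$. $\|\xi\bmod p\|_2=\Big(\sum_{x\in\mathbb{Z}/p\mathbb{Z}}\Pr[\xi\equiv x \bmod p]^2\Big)^{1/2}$ is the $l^2$ norm of the distribution of the reduction of $\xi$ modulo $p$. An affine translate of a subring $S\subset R$ is a set of the form $\{us+b : s\in S\}$ with $u,b\in R$; subrings contain $1$. *)

(* Defs.v *)
From HB Require Import structures.
From mathcomp Require Import all_boot all_order all_algebra.
From mathcomp Require Import boolp classical_sets reals.

Set Implicit Arguments.
Unset Strict Implicit.
Unset Printing Implicit Defensive.

Import Order.TTheory GRing.Theory Num.Theory.

Local Open Scope ring_scope.

Record fdist (R : realType) (T : finType) := FDist {
  pmf :> T -> R;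
  pmf_ge0 : forall x, 0 <= pmf x;
  pmf_sum1 : \sum_x pmf x = 1 }.

Section FiniteProbability.
Variable R : realType.

Definition prob (T : finType) (P : fdist R T) (E : set T) : R :=
  \sum_(x | `[< E x >]) P x.

(* X and Y may be defined on different finite probability spaces; they take
   values in an arbitrary set V, all of whose subsets are events. *)
Definition d_TV (S T : finType) (V : Type) (P : fdist R S) (X : S -> V)
    (Q : fdist R T) (Y : T -> V) : R :=
  sup [set `|prob P (X @^-1` A)%classic - prob Q (Y @^-1` A)%classic|
        | A in [set: set V]]%classic.

Section Uniform.
Variables (T : finType) (T_gt0 : (0 < #|T|)%N).

Definition uniform_pmf (_ : T) : R := #|T|%:R^-1.

Lemma uniform_ge0 x : 0 <= uniform_pmf x.
Proof. by rewrite invr_ge0 ler0n. Qed.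

Lemma uniform_sum1 : \sum_x uniform_pmf x = 1.
Proof. by rewrite /uniform_pmf sumr_const -[LHS]mulr_natl mulfV // pnatr_eq0 -lt0n. Qed.

Definition uniform : fdist R T := FDist uniform_ge0 uniform_sum1.

End Uniform.

(* The joint law of an independent family, indexed by I, of random variables
   with common law P. *)
Section IID.
Variables (I T : finType) (P : fdist R T).

Definition iid_pmf (w : {ffun I -> T}) : R := \prod_i P (w i).

Lemma iid_ge0 w : 0 <= iid_pmf w.
Proof. by apply: prodr_ge0 => i _; exact: pmf_ge0. Qed.

Lemma iid_sum1 : \sum_w iid_pmf w = 1.
Proof.
rewrite -(bigA_distr_bigA (fun (_ : I) x => P x)).
by apply: big1 => i _; rewrite pmf_sum1.
Qed.

Definition iid : fdist R {ffun I -> T} := FDist iid_ge0 iid_sum1.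

End IID.

Section RandomMatrix.
Variables (A : finType) (m n : nat) (P : fdist R A).

Definition iid_mx_pmf (M : 'M[A]_(m, n)) : R := \prod_i \prod_j P (M i j).

Lemma iid_mx_ge0 M : 0 <= iid_mx_pmf M.
Proof.
by apply: prodr_ge0 => i _; apply: prodr_ge0 => j _; exact: pmf_ge0.
Qed.

Lemma iid_mx_sum1 : \sum_M iid_mx_pmf M = 1.
Proof.
rewrite -(iid_sum1 ('I_m * 'I_n)%type P).
rewrite (reindex (fun w : {ffun 'I_m * 'I_n -> A} => \matrix_(i, j) w (i, j))).
  apply: eq_bigr => w _; rewrite /iid_mx_pmf pair_big /=.
  by apply: eq_bigr => -[i j] _; rewrite mxE.
exists (fun M : 'M[A]_(m, n) => [ffun ij => M ij.1 ij.2]) => [w|M] _.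
  by apply/ffunP => -[i j]; rewrite ffunE mxE.
by apply/matrixP => i j; rewrite mxE ffunE.
Qed.

(* The law of a random matrix with independent entries of law P. *)
Definition iid_mx : fdist R 'M[A]_(m, n) := FDist iid_mx_ge0 iid_mx_sum1.

End RandomMatrix.

Lemma card_mx_gt0 (A : finNzRingType) (m n : nat) : (0 < #|{: 'M[A]_(m, n)}|)%N.
Proof. by apply/card_gt0P; exists 0. Qed.

Definition uniform_mx (A : finNzRingType) (m n : nat) : fdist R 'M[A]_(m, n) :=
  uniform (card_mx_gt0 A m n).

(* The l^2 norm of the law of the reduction mod p of xi; meant for 1 < p and
   p %| n, so that 'Z_p is Z/p and the reduction is well defined. *)
Definition l2norm_mod (n p : nat) (xi : fdist R 'Z_n) : R :=
  Num.sqrt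
    (\sum_(x : 'Z_p) prob xi [set y : 'Z_n | (y : nat)%:R = x]%classic ^+ 2).

End FiniteProbability.

(* xi is supported in {u s + b : s \in S} for some proper subring S; as
   subring_closed S includes 1 \in S, subrings are unital. *)
Definition concentrated_on_affine_proper_subring
    (R : realType) (A : finComNzRingType) (xi : fdist R A) : Prop :=
  exists (S : {set A}) (u b : A),
    [/\ subring_closed S, S != [set: A]%SET &
        forall x, xi x != 0 -> exists2 s, s \in S & x = u * s + b].

Definition SL_right_invariant
    (A : comNzRingType) (N : nat) (V : Type) (f : 'M[A]_N -> V) : Prop :=
  forall M g : 'M[A]_N, \det g = 1 -> f (M *m g) = f M.

(* M_1 M_2 ... M_k, in this order. *)
Definition prod_mx (A : nzRingType) (N k : nat)
    (M : {ffun 'I_k -> 'M[A]_N}) : 'M[A]_N :=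
  \big[mulmx/1%:M]_(i < k) M i.

(* Main.v *)
(* Only the last factor of M_1 ... M_k is exchanged for a uniform matrix at first:
   f (M_1 ... M_(k-1) X) is SL_N-invariant in X, and once X is uniform, its law
   given M_1 ... M_(k-1) is again an SL_N-invariant function of that product. So
   k = 1 suffices, at the cost of the factor k.

   For one matrix, the columns are made uniform one at a time. Given the other
   columns, an invariant function of the matrix depends on the column v only
   modulo their span, so that by Fourier inversion the exchange costs at most
   the sum over w <> 0 orthogonal to the other columns of prod_i |xi^(w_i)|.
   Averaging over the other columns multiplies the term of w by about
   Pr[w.v = 0]^(N-1).

   If w is far from sparse, that probability is about |R|^-1 because
   |xi^(y)| <= rho < 1 for y <> 0, and the sum over w is then about
   (|R|^-1 sum_y |xi^(y)|)^N, at most ||xi mod p||_2^N by Cauchy-Schwarz and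
   Parseval. In general let c be least such that p^c w is sparse: Pr[w.v = 0] is
   about |Ann p^c|^-1 Pr[p^c w.v = 0], the last factor being at most
   ||xi mod p||_2 when p^c w <> 0, and there are only e^(eps N) |Ann p^c|^N such
   vectors w. The case p^c w = 0 is as before, over the ideal Ann p^c. *)

Require Import Defs.
From HB Require Import structures.
From mathcomp Require Import all_boot all_order all_algebra.
From mathcomp Require Import boolp classical_sets reals sequences exp.
From mathcomp Require Import cyclic separable cyclotomic complex ring lra.

Set Implicit Arguments.
Unset Strict Implicit.
Unset Printing Implicit Defensive.

Import Order.TTheory GRing.Theory Num.Theory.

Local Open Scope ring_scope.

(** * Fourier analysis over a finite ring *)

Lemma card_ring_gt0 (A : finNzRingType) : (0 < #|A|)%N.
Proof. by apply/card_gt0P; exists 0. Qed.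

Section Fourier.
Local Open Scope complex_scope.
Variables (R : realType) (A : finComUnitRingType) (psi : A -> R[i]).
Hypotheses (psiD : forall x y, psi (x + y) = psi x * psi y)
  (psi_norm : forall x, `|psi x| = 1)
  (psi_nondeg : forall z, (forall y, psi (y * z) = 1) -> z = 0).

Implicit Types (nu : fdist R A) (r t y z : A).

Definition annihilator r : {set A} := [set y | r * y == 0].

Lemma psi_neq0 y : psi y != 0.
Proof. by rewrite -normr_eq0 psi_norm oner_eq0. Qed.

Lemma psi0 : psi 0 = 1.
Proof. by apply: (mulfI (psi_neq0 0)); rewrite -psiD addr0 mulr1. Qed.

Lemma psi_sum (I : finType) (F : I -> A) : psi (\sum_i F i) = \prod_i psi (F i).
Proof. by rewrite (big_morph psi psiD psi0). Qed.

Lemma psiN y : psi (- y) = (psi y)^*%R.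
Proof.
apply: (mulfI (psi_neq0 y)).
by rewrite -psiD subrr psi0 -normCK psi_norm expr1n.
Qed.

(** If some [y0] killed by [r] has [psi (y0 * z) != 1], translating by [y0] multiplies the sum by
    that factor, so the sum vanishes. *)
Lemma sum_psi_annihilator r z :
  \sum_(y | r * y == 0) psi (y * z) =
  (#|annihilator r| * [forall y, (r * y == 0) ==> (psi (y * z) == 1)])%:R.
Proof.
have [/forallP H|] := boolP [forall y, (r * y == 0) ==> (psi (y * z) == 1)].
  rewrite muln1 -sum1_card natr_sum big_mkcond [RHS]big_mkcond /=.
  by apply: eq_bigr => y _; rewrite inE; have /implyP := H y; case: eqP => // _ /(_ isT) /eqP.
rewrite negb_forall => /existsP[y0]; rewrite negb_imply => /andP[/eqP y0r y0z].
rewrite muln0; set S := LHS.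
have : S = psi (y0 * z) * S.
  rewrite {1}/S (reindex_inj (addrI y0)) /= mulr_sumr.
  apply: eq_big => y; first by rewrite mulrDr y0r add0r.
  by rewrite mulrDl psiD.
move/eqP; rewrite -subr_eq0 -{1}[S]mul1r -mulrBl mulf_eq0 subr_eq0 eq_sym.
by rewrite (negbTE y0z) => /eqP.
Qed.

Lemma sum_psi z : \sum_y psi (y * z) = (#|A| * (z == 0))%:R.
Proof.
transitivity (\sum_(y | 0 * y == 0) psi (y * z)).
  by apply: eq_bigl => y; rewrite mul0r eqxx.
rewrite sum_psi_annihilator; congr (_ * _)%:R.
  by apply: eq_card => y; rewrite inE mul0r eqxx.
congr nat_of_bool; apply/forallP/eqP => [H|-> y].
  by apply: psi_nondeg => y; have := H y; rewrite mul0r eqxx => /eqP.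
by rewrite mulr0 psi0 eqxx implybT.
Qed.

Definition fourier nu y : R[i] := \sum_x (nu x)%:C * psi (y * x).

Definition amplitude nu y : R := complex.Re `|fourier nu y|.

Lemma amplitudeE nu y : (amplitude nu y)%:C = `|fourier nu y|.
Proof. by rewrite RRe_real // normr_real. Qed.

Lemma amplitude_ge0 nu y : 0 <= amplitude nu y.
Proof. by rewrite -ler0c amplitudeE. Qed.

Lemma norm_pmfC (T : finType) (P : fdist R T) x : `|(P x)%:C| = (P x)%:C.
Proof. by rewrite ger0_norm // lecR pmf_ge0. Qed.

Lemma sum_pmfC (T : finType) (P : fdist R T) : \sum_x (P x)%:C = 1.
Proof. by rewrite -rmorph_sum pmf_sum1. Qed.

Lemma amplitude_le1 nu y : amplitude nu y <= 1.
Proof.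
rewrite -lecR amplitudeE (le_trans (ler_norm_sum _ _ _)) //.
under eq_bigr do rewrite normrM psi_norm mulr1 norm_pmfC.
by rewrite sum_pmfC.
Qed.

Lemma fourier0 nu : fourier nu 0 = 1.
Proof.
by rewrite /fourier; under eq_bigr do rewrite mul0r psi0 mulr1; rewrite sum_pmfC.
Qed.

Lemma amplitude0 nu : amplitude nu 0 = 1.
Proof. by rewrite /amplitude fourier0 normr1. Qed.

(** Equality in the triangle inequality would make [psi (y * x)] constant on the support of [nu]. *)
Lemma amplitude_lt1 nu y x x' : nu x != 0 -> nu x' != 0 -> y * (x - x') != 0 ->
  (forall z, z != 0 -> psi z != 1) -> amplitude nu y < 1.
Proof.
move=> nux nux' yxx' psi_inj; rewrite lt_neqAle amplitude_le1 andbT.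
apply/negP => /eqP amp1; set c := fourier nu y.
have c1 : `|c| = 1 by rewrite -amplitudeE amp1.
have E x0 : nu x0 != 0 -> psi (y * x0) * c^*%R = 1.
  (* Multiplied by the conjugate of [c], the sum becomes 1, which is also the sum of the bounds
     [nu x]; so every term attains its bound. *)
  move=> nux0; have := @normC_sum_upper _ _ predT
    (fun x => (nu x)%:C * psi (y * x) * c^*%R) (fun x => (nu x)%:C).
  move=> /(_ _ _ x0 isT); rewrite -mulrA => H.
  apply: (@mulfI _ (nu x0)%:C); first by rewrite (inj_eq (@complexI _)).
  rewrite mulr1; apply: H => [z _|].
    by rewrite !normrM psi_norm norm_conjC c1 !mulr1 norm_pmfC.
  by rewrite -mulr_suml -/c -normCK c1 expr1n sum_pmfC.
have /eqP : psi (y * (x - x')) = 1.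
  rewrite mulrBr psiD psiN.
  have E' : (psi (y * x'))^*%R * c = 1.
    by rewrite -[X in _ * X](@conjCK R[i]) -rmorphM (E _ nux') rmorph1.
  have := congr2 *%R (E _ nux) E'.
  by rewrite mulrACA [_^*%R * c]mulrC -normCK c1 expr1n !mulr1.
by rewrite (negbTE (psi_inj _ yxx')).
Qed.

(** The probability that two independent samples of [nu] differ by an element satisfying [e]. *)
Definition collision nu (e : pred A) : R :=
  \sum_x \sum_x' nu x * nu x' * (e (x - x'))%:R.

(** Parseval on a subgroup: the square expands into characters [psi (y * (x - x'))], which are then
    summed over the annihilator. *)
Lemma parseval_annihilator nu r :
  \sum_(y | r * y == 0) amplitude nu y ^+ 2 =
  #|annihilator r|%:R *
    collision nu (fun z => [forall y, (r * y == 0) ==> (psi (y * z) == 1)]).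
Proof.
apply: (@complexI R); rewrite rmorph_sum rmorphM /= rmorph_nat /collision.
under eq_bigr do rewrite rmorphXn /= amplitudeE normCK /fourier rmorph_sum big_distrlr /=.
rewrite exchange_big rmorph_sum /= mulr_sumr; apply: eq_bigr => x _.
rewrite exchange_big rmorph_sum /= mulr_sumr; apply: eq_bigr => x' _.
rewrite !rmorphM /= rmorph_nat mulrCA -natrM -sum_psi_annihilator mulr_sumr.
apply: eq_bigr => y _; rewrite rmorphM /= -psiN mulrACA -psiD mulrBr.
by rewrite conj_Creal // ger0_real // lecR pmf_ge0.
Qed.

(** * Random vectors and their orthogonality to a frequency vector *)

Variable I : finType.
Local Notation vec := {ffun I -> A}.

Definition dot (w v : vec) : A := \sum_i w i * v i.

Lemma dotDr w v v' : dot w (v + v') = dot w v + dot w v'.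
Proof. by rewrite /dot -big_split; apply: eq_bigr => i _; rewrite ffunE mulrDr. Qed.

Definition scale_vec t (v : vec) : vec := [ffun i => t * v i].

Lemma dotZr t w v : dot w (scale_vec t v) = t * dot w v.
Proof. by rewrite /dot mulr_sumr; apply: eq_bigr => i _; rewrite ffunE mulrCA. Qed.

Lemma dotZl t w v : dot (scale_vec t w) v = t * dot w v.
Proof. by rewrite /dot mulr_sumr; apply: eq_bigr => i _; rewrite ffunE mulrA. Qed.

Lemma sum_iid_psi_dot nu w :
  \sum_v (iid I nu v)%:C * psi (dot w v) = \prod_i fourier nu (w i).
Proof.
rewrite (bigA_distr_bigA (fun i x => (nu x)%:C * psi (w i * x))).
by apply: eq_bigr => v _; rewrite big_split /= rmorph_prod psi_sum.
Qed.

Lemma sum_psi_dot v : \sum_w psi (dot w v) = (#|vec| * (v == 0))%:R.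
Proof.
transitivity (\sum_(w : vec) \prod_i psi (w i * v i)).
  by apply: eq_bigr => w _; rewrite psi_sum.
rewrite -(bigA_distr_bigA (fun i t => psi (t * v i))) /=.
under eq_bigr do rewrite sum_psi.
rewrite -natr_prod; congr _%:R.
rewrite big_split /= prod_nat_const card_ffun; congr muln.
have [->|v0] := eqVneq v 0; first by apply: big1 => i _; rewrite ffunE eqxx.
have [i vi] : exists i, v i != 0.
  apply/existsP; rewrite -negb_forall; apply: contra v0 => /forallP H.
  by apply/eqP/ffunP => i; rewrite ffunE; apply/eqP.
by rewrite (bigD1 i) //= (negbTE vi).
Qed.

Definition orth_prob nu (w : vec) : R := \sum_v iid I nu v * (dot w v == 0)%:R.

Lemma orth_prob_ge0 nu w : 0 <= orth_prob nu w.
Proof. by apply: sumr_ge0 => v _; rewrite mulr_ge0 // pmf_ge0. Qed.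

(** The indicator of [dot w v == 0] is the average over [t] of [psi (t * dot w v)], whose mean
    factors over the coordinates. *)
Lemma orth_probE nu w :
  (orth_prob nu w)%:C = #|A|%:R^-1 * \sum_t \prod_i fourier nu (t * w i).
Proof.
have A0 : #|A|%:R != 0 :> R[i].
  by rewrite pnatr_eq0 -lt0n card_ring_gt0.
apply: (mulfI A0); rewrite mulVKf // /orth_prob rmorph_sum mulr_sumr.
under [RHS]eq_bigr => t _.
  under eq_bigr do rewrite -[t * _](ffunE (fun i => t * w i)) -/(scale_vec t w).
  rewrite -sum_iid_psi_dot; under eq_bigr do rewrite dotZl.
over.
rewrite exchange_big; apply: eq_bigr => v _.
by rewrite -mulr_sumr sum_psi rmorphM /= rmorph_nat mulrCA -natrM.
Qed.

Lemma card_annihilator_gt0 r : (0 < #|annihilator r|)%N.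
Proof. by apply/card_gt0P; exists 0; rewrite inE mulr0. Qed.

(** The fibres of multiplication by [r] over its image are the cosets of its annihilator. *)
Lemma sum_mul_fiber (V : nmodType) r (G : A -> V) :
  \sum_s G (r * s) =
  (\sum_(t | [exists s, t == r * s]) G t) *+ #|annihilator r|.
Proof.
rewrite (partition_big (fun s => r * s) (fun t => [exists s, t == r * s])) /=; last first.
  by move=> s _; apply/existsP; exists s.
rewrite -sumrMnl; apply: eq_bigr => t /existsP[s0 /eqP ->].
under eq_bigr => s /eqP -> do []; rewrite sumr_const; congr (_ *+ _).
rewrite -(card_imset (annihilator r) (addrI s0)).
apply: eq_card => s; rewrite unfold_in; apply/eqP/imsetP => [E|[y]].
  exists (s - s0); last by rewrite addrC subrK.
  by rewrite inE mulrBr E subrr.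
by rewrite inE => /eqP y0 ->; rewrite mulrDr y0 addr0.
Qed.

(* The frequencies t in the ideal r A contribute exactly the probability that
   r w is orthogonal to v, up to the index of the annihilator of r. *)
Lemma orth_prob_le nu (w : vec) r (tau : R) : 0 <= tau ->
  (forall t, [exists s, t == r * s] \/ \prod_i amplitude nu (t * w i) <= tau) ->
  orth_prob nu w <=
    #|annihilator r|%:R^-1 * orth_prob nu (scale_vec r w) + tau.
Proof.
move=> tau0 H; set K := #|_|.
have K0 : K%:R != 0 :> R[i] by rewrite pnatr_eq0 -lt0n card_annihilator_gt0.
have A0 : 0 < #|A|%:R :> R[i].
  by rewrite ltr0n card_ring_gt0.
rewrite -lerBlDl (le_trans (ler_norm _)) // -lecR.
set D := `|_ - _|.
have -> : D%:C = `|#|A|%:R^-1 * \sum_(t | ~~ [exists s, t == r * s])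
                                    \prod_i fourier nu (t * w i)|.
  have <- : (orth_prob nu w - K%:R^-1 * orth_prob nu (scale_vec r w))%:C =
     #|A|%:R^-1 * \sum_(t | ~~ [exists s, t == r * s]) \prod_i fourier nu (t * w i).
    rewrite rmorphB rmorphM /= fmorphV rmorph_nat !orth_probE.
    under [X in _ - _ * (_ * X)]eq_bigr => t _.
      under eq_bigr do rewrite ffunE mulrA [t * r]mulrC.
    over.
    rewrite (sum_mul_fiber r (fun t => \prod_i fourier nu (t * w i))) -/K.
    rewrite -[X in _ - _ * (_ * X)]mulr_natl [X in _ - _ * X]mulrCA mulKf //.
    rewrite (bigID (fun t => [exists s, t == r * s])) /= mulrDr addrAC subrr add0r //.
  by rewrite /D normc_def /= expr0n addr0 sqrtr_sqr.
rewrite normrM (@ger0_norm _ #|A|%:R^-1) ?invr_ge0 ?ler0n // ler_pdivrMl //.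
rewrite (le_trans (ler_norm_sum _ _ _)) //.
rewrite mulr_natl -sumr_const big_mkcond ler_sum // => t _.
case: ifP => [tr|_]; last by rewrite lecR.
have [|] := H t; first by rewrite (negbTE tr).
rewrite -lecR rmorph_prod /= normr_prod.
by under eq_bigr do rewrite amplitudeE.
Qed.

(* A function of the vector v which is invariant under translation by a
   submodule has its Fourier transform supported on the orthogonal of it. *)
Lemma iid_translation_invariant_diff nu nu' (g : vec -> R) (L : pred vec) :
  (forall y, y != 0 -> fourier nu' y = 0) ->
  (forall v, 0 <= g v <= 1) ->
  (forall u, L u -> forall t v, g (v + scale_vec t u) = g v) ->
  `|\sum_v iid I nu v * g v - \sum_v iid I nu' v * g v| <=
  \sum_(w : vec | (w != 0) && [forall (u | L u), dot w u == 0])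
     \prod_i amplitude nu (w i).
Proof.
move=> nu'0 g01 gL.
pose gh (w : vec) := \sum_v (g v)%:C * psi (- dot w v).
have V0 : 0 < #|vec|%:R :> R[i] by rewrite ltr0n; apply/card_gt0P; exists 0.
have gh_le w : `|gh w| <= #|vec|%:R.
  rewrite (le_trans (ler_norm_sum _ _ _)) // -sum1_card natr_sum ler_sum // => v _.
  have /andP[g0 g1] := g01 v.
  by rewrite normrM psi_norm mulr1 ger0_norm lecR.
(* Some multiple of [u] gives a translation that fixes [g] but multiplies [gh w] by a value of [psi]
   other than 1. *)
have gh0 w : ~~ [forall (u | L u), dot w u == 0] -> gh w = 0.
  rewrite negb_forall => /existsP[u]; rewrite negb_imply => /andP[Lu wu].
  have [t tz] : exists t, psi (t * - dot w u) != 1.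
    apply/existsP; rewrite -negb_forall; apply: contra wu => /forallP H.
    rewrite -oppr_eq0; apply/eqP/psi_nondeg => t; exact/eqP.
  have : gh w = psi (t * - dot w u) * gh w.
    rewrite {1}/gh (reindex_inj (addrI (scale_vec t u))) /= mulr_sumr.
    apply: eq_bigr => v _; rewrite [_ + v]addrC gL // dotDr opprD psiD dotZr.
    by rewrite mulrN mulrA mulrC.
  move/eqP; rewrite -subr_eq0 -{1}[gh w]mul1r -mulrBl mulf_eq0 subr_eq0 eq_sym.
  by rewrite (negbTE tz) => /eqP.
have inversion v : #|vec|%:R * (g v)%:C = \sum_w gh w * psi (dot w v).
  rewrite /gh; under eq_bigr do rewrite mulr_suml.
  rewrite exchange_big /= (bigD1 v) //= [X in _ = _ + X]big1 ?addr0.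
    under eq_bigr do rewrite -mulrA -psiD addNr psi0 mulr1.
    by rewrite sumr_const mulr_natl.
  move=> v' v'v.
  have N w : - dot w v' = dot w (- v').
    by rewrite /dot -sumrN; apply: eq_bigr => i _; rewrite ffunE mulrN.
  under eq_bigr do rewrite -mulrA -psiD N -dotDr.
  by rewrite -mulr_sumr sum_psi_dot addrC subr_eq0 eq_sym (negbTE v'v) muln0 mulr0.
have E mu : #|vec|%:R * (\sum_v iid I mu v * g v)%:C =
    \sum_w gh w * \prod_i fourier mu (w i).
  rewrite rmorph_sum mulr_sumr.
  under eq_bigr do rewrite rmorphM /= mulrCA inversion mulr_sumr.
  rewrite exchange_big; apply: eq_bigr => w _; rewrite -sum_iid_psi_dot mulr_sumr.
  by apply: eq_bigr => v _; rewrite mulrCA.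
(* Frequency 0 contributes [gh 0] under both laws and cancels; at every other frequency the [nu']
   term is zero. *)
have D : #|vec|%:R * (\sum_v iid I nu v * g v - \sum_v iid I nu' v * g v)%:C =
    \sum_(w : vec | (w != 0) && [forall (u | L u), dot w u == 0])
      gh w * \prod_i fourier nu (w i).
  rewrite rmorphB mulrBr !E -sumrB (bigD1 (0 : vec)) //=.
  have P0 mu : \prod_i fourier mu ((0 : vec) i) = 1.
    by apply: big1 => i _; rewrite ffunE fourier0.
  rewrite !P0 subrr add0r.
  rewrite big_mkcondr /=; apply: eq_bigr => w w0.
  have [i wi] : exists i, w i != 0.
    apply/existsP; rewrite -negb_forall; apply: contra w0 => /forallP H.
    by apply/eqP/ffunP => i; rewrite ffunE; apply/eqP.
  rewrite [X in _ - _ * X](bigD1 i) //= nu'0 // mul0r mulr0 subr0.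
  by case: ifPn => // /gh0 ->; rewrite mul0r.
rewrite -lecR -(ler_pM2l V0).
have -> : #|vec|%:R * `|\sum_v iid I nu v * g v - \sum_v iid I nu' v * g v|%:C =
   `|\sum_(w : vec | (w != 0) && [forall (u | L u), dot w u == 0])
      gh w * \prod_i fourier nu (w i)|.
  rewrite -D normrM ger0_norm ?ler0n //; congr (_ * _).
  by rewrite [RHS]normc_def /= expr0n addr0 sqrtr_sqr.
rewrite (le_trans (ler_norm_sum _ _ _)) // rmorph_sum mulr_sumr ler_sum // => w _.
rewrite normrM ler_pM //= rmorph_prod normr_prod /=.
by under [leRHS]eq_bigr do rewrite amplitudeE.
Qed.

End Fourier.

(** * Exchanging columns *)

Section Resampling.
Variables (R : realType) (T : finType).

Definition update (J : finType) (B : {ffun J -> T}) (j : J) (v : T) : {ffun J -> T} :=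
  [ffun l => if l == j then v else B l].

(** Swapping [B j] with [v] is an involution on the pairs [(B, v)]. It turns entry [j] into a dummy
    of total weight 1 and puts the sum over the real entry innermost. *)
Lemma sum_resample (J : finType) (mu : J -> T -> R) (j : J) (c : T -> R)
    (G : {ffun J -> T} -> R) : \sum_v c v = 1 ->
  \sum_(B : {ffun J -> T}) (\prod_(l | l != j) mu l (B l)) * G B =
  \sum_(B : {ffun J -> T}) (\prod_(l | l != j) mu l (B l)) * c (B j) * \sum_v G (update B j v).
Proof.
move=> c1; symmetry.
under eq_bigr do rewrite mulr_sumr.
rewrite pair_big /=.
pose h (x : {ffun J -> T} * T) := (update x.1 j x.2, x.1 j).
have hK : involutive h.
  case=> B v; rewrite /h /=; congr pair; last by rewrite ffunE eqxx.
  by apply/ffunP => l; rewrite !ffunE; case: eqP => [->|].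
rewrite (reindex_inj (inv_inj hK)) /=.
rewrite -(pair_bigA _ (fun B v => (\prod_(l | l != j) mu l (update B j v l)) *
   c (update B j v j) * G (update (update B j v) j (B j)))) /=.
apply: eq_bigr => B _; rewrite -[RHS]mul1r -c1 mulr_suml; apply: eq_bigr => v _.
have -> : update (update B j v) j (B j) = B.
  by apply/ffunP => l; rewrite !ffunE; case: eqP => [->|].
rewrite ffunE eqxx mulrAC mulrC; congr (_ * (_ * _)).
by apply: eq_bigr => l lj; rewrite ffunE (negbTE lj).
Qed.

(** Telescoping over hybrids whose first [k] entries have law [nu] and the others [mu]. The factor
    [mu (B j)] normalises the dummy entry, which [update] overwrites. *)
Lemma iid_hybrid_diff n (mu nu : fdist R T) (phi : {ffun 'I_n -> T} -> R) :
  `|\sum_B iid 'I_n mu B * phi B - \sum_B iid 'I_n nu B * phi B| <=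
  \sum_(j < n) \sum_(B : {ffun 'I_n -> T}) (\prod_(l | l != j) (if (l < j)%N then nu else mu) (B l)) * mu (B j) *
     `|\sum_v mu v * phi (update B j v) - \sum_v nu v * phi (update B j v)|.
Proof.
pose mix k (l : 'I_n) : fdist R T := if (l < k)%N then nu else mu.
pose E k := \sum_(B : {ffun 'I_n -> T}) (\prod_l mix k l (B l)) * phi B.
have -> : \sum_B iid 'I_n mu B * phi B = E 0%N by [].
have -> : \sum_B iid 'I_n nu B * phi B = E n.
  by apply: eq_bigr => B _; congr (_ * _); apply: eq_bigr => l _; rewrite /mix ltn_ord.
rewrite distrC -(telescope_sumr E (leq0n n)) big_mkord.
rewrite (le_trans (ler_norm_sum _ _ _)) // ler_sum // => j _.
have W (k : nat) (B : {ffun 'I_n -> T}) : (k == j :> nat \/ k == j.+1) ->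
    \prod_l mix k l (B l) = mix k j (B j) * \prod_(l | l != j) mix j l (B l).
  move=> kj; rewrite (bigD1 j) //=; congr (_ * _); apply: eq_bigr => l lj.
  case: kj => /eqP -> //; rewrite /mix ltnS leq_eqVlt.
  by rewrite (inj_eq val_inj) (negbTE lj).
have -> : E j.+1 - E j = - \sum_(B : {ffun 'I_n -> T}) (\prod_(l | l != j) mix j l (B l)) *
     (mu (B j) * phi B - nu (B j) * phi B).
  rewrite /E -sumrB -sumrN; apply: eq_bigr => B _.
  rewrite !W ?eqxx; [|by left|by right].
  rewrite {1 3}/mix ltnS leqnn ltnn; ring.
rewrite normrN (sum_resample (fun l => pmf (mix j l)) j
  (fun B => mu (B j) * phi B - nu (B j) * phi B) (pmf_sum1 mu)).
rewrite (le_trans (ler_norm_sum _ _ _)) // ler_sum // => B _.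
have W0 : 0 <= (\prod_(l | l != j) mix j l (B l)) * mu (B j).
  by rewrite mulr_ge0 ?pmf_ge0 // prodr_ge0 // => l _; exact: pmf_ge0.
rewrite normrM (ger0_norm W0) ler_wpM2l // -sumrB.
by under eq_bigr do rewrite ffunE eqxx.
Qed.

End Resampling.

(** * Column operations on one random matrix *)

Section OneMatrix.
Variables (R : realType) (A : finComUnitRingType).

Definition matrix_of_cols m n (B : {ffun 'I_n -> {ffun 'I_m -> A}}) : 'M[A]_(m, n) :=
  \matrix_(i, j) B j i.

Lemma sum_iid_mx m n (nu : fdist R A) (phi : 'M[A]_(m, n) -> R) :
  \sum_M iid_mx m n nu M * phi M =
  \sum_B iid 'I_n (iid 'I_m nu) B * phi (matrix_of_cols B).
Proof.
rewrite (reindex (@matrix_of_cols m n)) /=.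
  apply: eq_bigr => B _; congr (_ * _); rewrite /iid_mx_pmf /iid_pmf exchange_big /=.
  by apply: eq_bigr => j _; apply: eq_bigr => i _; rewrite mxE.
exists (fun M : 'M[A]_(m, n) => [ffun j => [ffun i => M i j]]) => [B|M] _.
  by apply/ffunP => j; apply/ffunP => i; rewrite !ffunE mxE.
by apply/matrixP => i j; rewrite mxE !ffunE.
Qed.

(** The matrix is lower triangular with unit diagonal if [j < l]; otherwise its transpose is. *)
Lemma det_transvection n (l j : 'I_n) (t : A) :
  l != j -> \det (1%:M + t *: delta_mx l j) = 1.
Proof.
move=> lj.
have D (C : 'M[A]_n) : C = 1%:M + t *: delta_mx l j \/ C = (1%:M + t *: delta_mx l j)^T ->
    \prod_i C i i = 1.
  move=> HC; apply: big1 => i _.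
  have -> : C i i = (1%:M + t *: delta_mx l j) i i by case: HC => ->; rewrite ?mxE.
  rewrite !mxE eqxx; case: eqP => [->|_]; rewrite ?(negbTE lj) ?mulr0 ?addr0 //.
have [jl|] := ltnP j l.
  rewrite det_trig; first by apply: D; left.
  apply/is_trig_mxP => i k ik; rewrite !mxE.
  have -> : (i == k) = false by apply: ltn_eqF.
  rewrite add0r; case: (i =P l) => [il|_]; last by rewrite mulr0.
  case: (k =P j) => [kj|_]; last by rewrite mulr0.
  by move: ik; rewrite il kj ltnNge (ltnW jl).
rewrite leq_eqVlt (inj_eq val_inj) (negbTE lj) /= => ljt.
rewrite -det_tr det_trig; first by apply: D; right.
apply/is_trig_mxP => i k ik; rewrite !mxE.
have -> : (k == i) = false by apply: gtn_eqF.
rewrite add0r; case: (k =P l) => [kl|_]; last by rewrite mulr0.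
case: (i =P j) => [ij|_]; last by rewrite mulr0.
by move: ik; rewrite ij kl ltnNge (ltnW ljt).
Qed.

(** Through this identity, SL-invariance becomes invariance under translating column [j] by
    multiples of the other columns. *)
Lemma matrix_of_cols_transvection m n (B : {ffun 'I_n -> {ffun 'I_m -> A}})
    (l j : 'I_n) (t : A) (v : {ffun 'I_m -> A}) : l != j ->
  matrix_of_cols (update B j (v + scale_vec t (B l))) =
  matrix_of_cols (update B j v) *m (1%:M + t *: delta_mx l j).
Proof.
move=> lj; rewrite mulmxDr mulmx1 -scalemxAr; apply/matrixP => i k.
rewrite !mxE (bigD1 l) //= big1 ?addr0 => [|x xl]; last first.
  by rewrite !mxE (negbTE xl) mulr0.
rewrite !mxE eqxx !ffunE (negbTE lj) /=.
by case: eqP => _; rewrite ?ffunE ?mulr1 ?mulr0 ?addr0.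
Qed.

Local Open Scope complex_scope.
Variable (psi : A -> R[i]).
Hypotheses (psiD : forall x y, psi (x + y) = psi x * psi y)
  (psi_norm : forall x, `|psi x| = 1)
  (psi_nondeg : forall z, (forall y, psi (y * z) = 1) -> z = 0).

(* Columns are exchanged one at a time: given the other columns, the value of
   phi only depends on column j modulo their span. *)
Lemma iid_mx_diff n (xi nu : fdist R A) (phi : 'M[A]_n -> R) :
  (forall y, y != 0 -> fourier psi nu y = 0) ->
  (forall M, 0 <= phi M <= 1) -> SL_right_invariant phi ->
  `|\sum_M iid_mx n n xi M * phi M - \sum_M iid_mx n n nu M * phi M| <=
  \sum_(j < n) \sum_(w : {ffun 'I_n -> A} | w != 0) (\prod_i amplitude psi xi (w i)) *
     \prod_(l | l != j) orth_prob (if (l < j)%N then nu else xi) w.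
Proof.
move=> nu0 phi01 phiSL; rewrite !sum_iid_mx.
rewrite (le_trans (iid_hybrid_diff _ _ _)) // ler_sum // => j _.
pose mix (l : 'I_n) := if (l < j)%N then nu else xi.
pose F (w : {ffun 'I_n -> A}) := \prod_i amplitude psi xi (w i).
pose W (B : {ffun 'I_n -> {ffun 'I_n -> A}}) :=
  (\prod_(l | l != j) iid 'I_n (mix l) (B l)) * iid 'I_n xi (B j).
apply: (@le_trans _ _ (\sum_B \sum_(w : {ffun 'I_n -> A} | w != 0)
   F w * (W B * [forall (l | l != j), dot w (B l) == 0]%:R))).
  apply: ler_sum => B _.
  have -> : (\prod_(l | l != j) (if (l < j)%N then iid 'I_n nu else iid 'I_n xi) (B l)) *
     iid 'I_n xi (B j) = W B.
    by congr (_ * _); apply: eq_bigr => l _; rewrite /mix; case: ifP.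
  have W0 : 0 <= W B.
    rewrite mulr_ge0 ?pmf_ge0 // prodr_ge0 // => l _; exact: pmf_ge0.
  have L := iid_translation_invariant_diff psiD psi_norm psi_nondeg xi nu0
    (g := fun v => phi (matrix_of_cols (update B j v)))
    (L := [pred u | [exists (l | l != j), u == B l]]).
  rewrite (le_trans (ler_wpM2l W0 (L _ _))) //.
    move=> u /existsP[l /andP[lj /eqP ->]] t v.
    by rewrite matrix_of_cols_transvection // phiSL // det_transvection.
  rewrite mulr_sumr big_mkcondr /= ler_sum // => w w0.
  have -> : [forall (u | [exists (l | l != j), u == B l]), dot w u == 0] =
            [forall (l | l != j), dot w (B l) == 0].
    apply/forall_inP/forall_inP => [H l lj|H u /existsP[l /andP[lj /eqP ->]]].
      by apply: H; apply/existsP; exists l; rewrite lj eqxx.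
    exact: H.
  by case: ifP => _; rewrite ?mulr1 ?mulr0 // mulrC.
rewrite exchange_big ler_sum //= => w w0.
rewrite -mulr_sumr ler_wpM2l //; first by apply: prodr_ge0 => i _; exact: amplitude_ge0.
rewrite le_eqVlt; apply/orP; left; apply/eqP.
(* The columns are independent, so the mean factors; the dummy column [j] contributes 1. *)
pose G l (v : {ffun 'I_n -> A}) : R :=
  if l == j then iid 'I_n xi v else iid 'I_n (mix l) v * (dot w v == 0)%:R.
transitivity (\prod_l \sum_v G l v).
  rewrite bigA_distr_bigA; apply: eq_bigr => B _.
  rewrite [RHS](bigD1 j) //= /G eqxx /W mulrAC mulrC; congr (_ * _).
  have -> : [forall (l | l != j), dot w (B l) == 0]%:R =
      \prod_(l | l != j) (dot w (B l) == 0)%:R :> R.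
    have [/forall_inP H|] := boolP [forall (l | l != j), dot w (B l) == 0].
      by rewrite big1 // => l lj; rewrite H.
    rewrite negb_forall => /existsP[l]; rewrite negb_imply => /andP[lj wl].
    by rewrite (bigD1 l) //= (negbTE wl) mul0r.
  by rewrite -big_split; apply: eq_bigr => l lj; rewrite (negbTE lj).
rewrite (bigD1 j) //= {1}/G eqxx.
rewrite iid_sum1.
rewrite mul1r; apply: eq_bigr => l lj; rewrite /orth_prob.
by apply: eq_bigr => v _; rewrite /G (negbTE lj).
Qed.

End OneMatrix.

(** * Products of matrices *)

Lemma mean_itv (R : realType) (T : finType) (P : fdist R T) (phi : T -> R) :
  (forall x, 0 <= phi x <= 1) -> 0 <= \sum_x P x * phi x <= 1.
Proof.
move=> H; apply/andP; split.
  by apply: sumr_ge0 => x _; rewrite mulr_ge0 ?pmf_ge0 //; have /andP[] := H x.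
rewrite -(pmf_sum1 P) ler_sum // => x _.
by rewrite ler_piMr ?pmf_ge0 //; have /andP[] := H x.
Qed.

Lemma mean_diff_le1 (R : realType) (T : finType) (P Q : fdist R T) (phi : T -> R) :
  (forall x, 0 <= phi x <= 1) ->
  `|\sum_x P x * phi x - \sum_x Q x * phi x| <= 1.
Proof.
move=> H; have /andP[? ?] := mean_itv P H; have /andP[? ?] := mean_itv Q H.
by rewrite ler_norml; apply/andP; split; lra.
Qed.

Lemma prob_preimage (R : realType) (T : finType) (V : Type) (P : fdist R T) (X : T -> V) (E : set V) :
  prob P (X @^-1` E)%classic = \sum_x P x * `[< E (X x) >]%:R.
Proof.
rewrite /prob big_mkcond; apply: eq_bigr => x _.
by rewrite /preimage /=; case: asboolP => _; rewrite ?mulr1 ?mulr0.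
Qed.

Lemma d_TV_le (R : realType) (S T : finType) (V : Type) (P : fdist R S) (X : S -> V)
    (Q : fdist R T) (Y : T -> V) (b : R) :
  (forall E : set V, `|prob P (X @^-1` E)%classic - prob Q (Y @^-1` E)%classic| <= b) ->
  d_TV P X Q Y <= b.
Proof.
move=> H; apply: ge_sup; first by eexists; exists setT.
by move=> _ [E _ <-]; exact: H.
Qed.

Section MatrixProducts.
Variables (R : realType) (A : finComUnitRingType) (N : nat).
Local Notation mx := 'M[A]_N.
Implicit Types (mu nu : fdist R mx) (phi : mx -> R).

Fixpoint prod_mean mu k phi : R :=
  if k is k'.+1 then \sum_M mu M * prod_mean mu k' (fun X => phi (M *m X))
  else phi 1%:M.

Lemma prod_meanE mu k phi :
  \sum_w iid 'I_k mu w * phi (prod_mx w) = prod_mean mu k phi.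
Proof.
elim: k phi => [|k IHk] phi /=.
  rewrite (bigD1 [ffun i : 'I_0 => 0]) //= big1 ?addr0 => [|w].
    by rewrite /iid_pmf /prod_mx !big_ord0 mul1r.
  by case/eqP; apply/ffunP; case.
pose cons_ffun (x : mx * {ffun 'I_k -> mx}) : {ffun 'I_k.+1 -> mx} :=
  [ffun i => if unlift ord0 i is Some j then x.2 j else x.1].
rewrite (reindex cons_ffun) /=; last first.
  exists (fun w => (w ord0, [ffun i => w (lift ord0 i)])) => [[M w]|w] _.
    rewrite /cons_ffun; congr pair; first by rewrite ffunE unlift_none.
    by apply/ffunP => i; rewrite !ffunE liftK.
  by apply/ffunP => i; rewrite ffunE; case: unliftP => [j|] ->; rewrite ?ffunE.
rewrite -(pair_bigA _ (fun M w => iid_pmf mu (cons_ffun (M, w)) *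
  phi (prod_mx (cons_ffun (M, w))))) /=.
apply: eq_bigr => M _; rewrite -IHk mulr_sumr; apply: eq_bigr => w _.
have E0 : cons_ffun (M, w) ord0 = M by rewrite ffunE unlift_none.
have E i : cons_ffun (M, w) (lift ord0 i) = w i by rewrite ffunE liftK.
rewrite /iid_pmf /prod_mx !big_ord_recl E0 -mulrA.
under eq_bigr do rewrite E.
by under [X in phi (_ *m X)]eq_bigr do rewrite E.
Qed.

Lemma prod_mean_itv mu k phi : (forall M, 0 <= phi M <= 1) ->
  0 <= prod_mean mu k phi <= 1.
Proof.
elim: k phi => [|k IHk] phi phi01 //=.
by apply: mean_itv => M; exact: IHk.
Qed.

(** The first factor absorbs [g], as [nu] is invariant on the left; for the empty product,
    [g = 1 *m g] and the invariance of [phi] is used. *)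
Lemma prod_mean_mull nu k phi (g : mx) :
  (forall M g, \det g = 1 -> nu (g *m M) = nu M) ->
  SL_right_invariant phi -> \det g = 1 ->
  prod_mean nu k (fun X => phi (g *m X)) = prod_mean nu k phi.
Proof.
move=> nuSL phiSL g1; case: k => [|k] /=.
  by rewrite mulmx1 -{1}[g]mul1mx phiSL.
have gU : g \in unitmx by rewrite unitmxE g1 unitr1.
rewrite [RHS](reindex (mulmx g)) /=; last first.
  by exists (mulmx (invmx g)) => M _; rewrite ?mulKmx ?mulKVmx.
apply: eq_bigr => M _; rewrite nuSL //; congr (_ * prod_mean _ _ _).
by apply/funext => X; rewrite mulmxA.
Qed.

(** With the first factor fixed, induction exchanges the [k] others at cost [k * D]; the remaining
    mean [h] is then an SL-invariant function of the first factor, which is exchanged at cost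
    [D]. *)
Lemma prod_mean_diff mu nu (D : R) k phi :
  (forall M g, \det g = 1 -> nu (g *m M) = nu M) ->
  (forall phi, (forall M, 0 <= phi M <= 1) -> SL_right_invariant phi ->
     `|\sum_M mu M * phi M - \sum_M nu M * phi M| <= D) ->
  (forall M, 0 <= phi M <= 1) -> SL_right_invariant phi ->
  `|prod_mean mu k phi - prod_mean nu k phi| <= k%:R * D.
Proof.
move=> nuSL muD; elim: k phi => [|k IHk] phi phi01 phiSL /=.
  by rewrite subrr normr0 mul0r.
pose h M := prod_mean nu k (fun X => phi (M *m X)).
rewrite -(subrK (\sum_M mu M * h M) (\sum_M mu M * _)) -addrA.
rewrite (le_trans (ler_normD _ _)) // -natr1 mulrDl mul1r lerD //.
  rewrite -sumrB (le_trans (ler_norm_sum _ _ _)) //.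
  rewrite -[leRHS]mul1r -[X in _ <= X * _](pmf_sum1 mu) mulr_suml ler_sum // => M _.
  rewrite -mulrBr normrM (ger0_norm (pmf_ge0 _ _)) ler_wpM2l ?pmf_ge0 //.
  rewrite /h; apply: IHk => [X|X g g1]; first exact: phi01.
  by rewrite mulmxA phiSL.
apply: muD => [M|M g g1]; first by apply: prod_mean_itv => X; exact: phi01.
rewrite /h -(prod_mean_mull (g := g) k nuSL (phi := fun X => phi (M *m X))) //.
  by congr prod_mean; apply/funext => X; rewrite mulmxA.
by move=> X g' g'1; rewrite mulmxA phiSL.
Qed.

Lemma d_TV_prod_mx_le mu nu (D : R) k (V : Type) (f : mx -> V) :
  (forall M g, \det g = 1 -> nu (g *m M) = nu M) ->
  (forall phi, (forall M, 0 <= phi M <= 1) -> SL_right_invariant phi ->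
     `|\sum_M mu M * phi M - \sum_M nu M * phi M| <= D) ->
  SL_right_invariant f ->
  d_TV (iid 'I_k mu) (fun M => f (prod_mx M)) (iid 'I_k nu) (fun M => f (prod_mx M))
  <= k%:R * D.
Proof.
move=> nuSL muD fSL; apply: d_TV_le => E.
pose phi M : R := `[< E (f M) >]%:R.
rewrite !prob_preimage !(prod_meanE _ _ phi).
apply: prod_mean_diff => // [M|M g g1]; last by rewrite /phi fSL.
by rewrite /phi; case: asboolP; rewrite ?ler01 ?lexx.
Qed.

End MatrixProducts.

(** * Chain rings *)

(** From [x <= expR (x - 1)], the power is at most the inverse of [n * (1 - x)], hence at most [y]
    for large [n]. *)
Lemma exists_expr_le (R : realType) (x y : R) :
  0 <= x < 1 -> 0 < y -> exists n, x ^+ n <= y.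
Proof.
move=> /andP[x0 x1] y0; pose n := Num.bound ((1 - x)^-1 / y); exists n.
have d0 : 0 < 1 - x by rewrite subr_gt0.
have xe : x <= (expR (1 - x))^-1.
  by rewrite -expRN opprB (le_trans _ (expR_ge1Dx _)) // addrC subrK.
rewrite (le_trans (lerXn2r n _ _ xe)) ?nnegrE ?invr_ge0 ?expR_ge0 //.
rewrite exprVn -expRM_natl invf_ple ?posrE ?expR_gt0 //.
have z0 : 0 <= (1 - x)^-1 / y by rewrite divr_ge0 ?invr_ge0 ?(ltW d0) ?(ltW y0).
have := archi_boundP z0; rewrite -/n => nb.
apply: le_trans (expR_ge1Dx _); apply: ler_wpDl => //.
by rewrite -ler_pdivrMr // mulrC ltW.
Qed.

(* A finite chain ring with maximal ideal generated by pi, of length a, with a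
   faithful additive character psi: the ring Z/p^a, with pi = p. *)
Section ChainRing.
Local Open Scope complex_scope.
Variables (R : realType) (A : finComUnitRingType) (psi : A -> R[i]).
Hypotheses (psiD : forall x y, psi (x + y) = psi x * psi y)
  (psi_norm : forall x, `|psi x| = 1)
  (psi_inj : forall z, z != 0 -> psi z != 1).
Variables (pi : A) (a : nat).
Hypotheses (a_gt0 : (0 < a)%N) (pi_a : pi ^+ a = 0) (pi_a1 : pi ^+ a.-1 != 0)
  (chain : forall t, exists e u, [/\ (e <= a)%N, u \is a GRing.unit & t = u * pi ^+ e]).

Local Notation amp := (amplitude psi).
Local Notation K c := (#|annihilator (pi ^+ c)|%:R : R).

Lemma psi_nondeg z : (forall y, psi (y * z) = 1) -> z = 0.
Proof.
move=> H; apply/eqP/negPn/negP => /psi_inj /negP; apply.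
by rewrite -[z]mul1r H.
Qed.

(** Membership of [z] in the maximal ideal, stated without forming the residue field. *)
Definition residue0 (z : A) : bool := pi ^+ a.-1 * z == 0.

(** A nonzero [y] is a unit times [pi ^+ e] with [e < a]; if [pi ^+ e] kills [z], so does
    [pi ^+ a.-1]. *)
Lemma mul_eq0_residue0 y z : y != 0 -> y * z = 0 -> residue0 z.
Proof.
have [e [u [ea uU ->]]] := chain y => y0; rewrite -mulrA => /eqP.
rewrite mulrI_eq0; last exact/mulrI.
have {}ea : (e <= a.-1)%N.
  rewrite -ltnS prednK // ltn_neqAle ea andbT; apply: contraNneq y0 => ->.
  by rewrite pi_a mulr0.
by rewrite /residue0 -(subnK ea) exprD -mulrA => /eqP ->; rewrite mulr0.
Qed.

(** The l^2 norm of the law reduced to the residue field: its square is the probability that two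
    samples have the same residue. *)
Definition residue_norm (nu : fdist R A) : R := Num.sqrt (collision nu residue0).

Lemma collision_ge0 (nu : fdist R A) e : 0 <= collision nu e.
Proof.
apply: sumr_ge0 => x _; apply: sumr_ge0 => x' _.
by rewrite !mulr_ge0 ?pmf_ge0.
Qed.

Lemma collision1 (nu : fdist R A) : collision nu predT = 1.
Proof.
rewrite /collision -[RHS](pmf_sum1 nu); apply: eq_bigr => x _.
by under eq_bigr do rewrite mulr1; rewrite -mulr_sumr pmf_sum1 mulr1.
Qed.

Lemma collision_le (nu : fdist R A) (e e' : pred A) :
  (forall z, e z -> e' z) -> collision nu e <= collision nu e'.
Proof.
move=> ee'; apply: ler_sum => x _; apply: ler_sum => x' _.
rewrite ler_wpM2l ?mulr_ge0 ?pmf_ge0 // ler_nat.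
by case: (e _) (ee' (x - x')) => // ->.
Qed.

Lemma residue_norm_ge0 nu : 0 <= residue_norm nu.
Proof. exact: sqrtr_ge0. Qed.

Lemma residue_norm_sqr nu : residue_norm nu ^+ 2 = collision nu residue0.
Proof. by rewrite sqr_sqrtr ?collision_ge0. Qed.

Lemma residue_norm_le1 nu : residue_norm nu <= 1.
Proof.
rewrite -sqrtr1 ler_wsqrtr // -(collision1 nu); exact: collision_le.
Qed.

Lemma annihilator_gt0 c : 0 < K c.
Proof. by rewrite ltr0n card_annihilator_gt0. Qed.

(** The test element is [pi ^+ a.-1], which [pi ^+ c] kills because [c > 0]. *)
Lemma residue0_annihilator c z : (0 < c <= a)%N ->
  [forall y, (pi ^+ c * y == 0) ==> (psi (y * z) == 1)] -> residue0 z.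
Proof.
move=> /andP[c0 ca] /forallP H; apply/negPn/negP => /psi_inj /negP; apply.
have := H (pi ^+ a.-1); rewrite -exprD => /implyP; apply.
have ac : (a <= c + a.-1)%N by rewrite -[leqLHS](prednK a_gt0) -add1n leq_add2r.
by rewrite -(subnK ac) exprD pi_a mulr0.
Qed.

Lemma sum_amplitude_sqr_le nu c : (0 < c <= a)%N ->
  \sum_(y | pi ^+ c * y == 0) amp nu y ^+ 2 <= K c * residue_norm nu ^+ 2.
Proof.
move=> ca; rewrite parseval_annihilator // residue_norm_sqr ler_wpM2l //.
by apply: collision_le => z; exact: residue0_annihilator.
Qed.

(** For [c = 1] equality holds, since the annihilator of [pi] is generated by [pi ^+ a.-1]. *)
Lemma sum_amplitude_sqr1 nu :
  \sum_(y | pi ^+ 1 * y == 0) amp nu y ^+ 2 = K 1 * residue_norm nu ^+ 2.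
Proof.
rewrite parseval_annihilator // residue_norm_sqr; congr (_ * _).
apply/le_anti/andP; split; apply: collision_le => z.
  by apply: residue0_annihilator; rewrite a_gt0.
move=> z0; apply/forallP => y; apply/implyP => y0.
suff -> : y * z = 0 by rewrite psi0.
have [e [u [ea uU E]]] := chain y.
move: y0; rewrite {}E expr1 mulrCA mulrI_eq0 -?exprS; last exact/mulrI.
have [->|ea1] := eqVneq e a; first by rewrite pi_a mulr0 mul0r.
have [->|ea2] := eqVneq e a.-1; first by rewrite -mulrA (eqP z0) mulr0.
have e1 : (e.+1 <= a.-1)%N.
  rewrite ltn_neqAle ea2 -ltnS prednK //=.
  by rewrite ltn_neqAle ea1.
by move=> /eqP E; case/eqP: pi_a1; rewrite -(subnK e1) exprD E mulr0.
Qed.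

Lemma residue_norm_gt0 nu : 0 < residue_norm nu.
Proof.
rewrite lt_neqAle residue_norm_ge0 andbT eq_sym; apply/eqP => E.
have := sum_amplitude_sqr1 nu; rewrite E expr0n mulr0 (bigD1 0) ?mulr0 //=.
rewrite amplitude0 // expr1n => /eqP; rewrite gt_eqF // ltr_wpDr ?ltr01 //.
by apply: sumr_ge0 => y _; exact: sqr_ge0.
Qed.

(** In Parseval over the annihilator of [pi], [nu'] has only the term [y = 0], which is 1 for every
    law. *)
Lemma residue_norm_min nu nu' : (forall y, y != 0 -> fourier psi nu' y = 0) ->
  residue_norm nu' <= residue_norm nu.
Proof.
move=> nu'0; rewrite -(ler_pXn2r (n := 2)) ?nnegrE ?residue_norm_ge0 //.
rewrite -(ler_pM2l (annihilator_gt0 1)) -!sum_amplitude_sqr1.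
rewrite ler_sum // => y _; have [->|y0] := eqVneq y 0.
  by rewrite !amplitude0.
by rewrite {1}/amplitude nu'0 // normr0 expr0n sqr_ge0.
Qed.

Lemma sum_amplitude_le nu c : (0 < c <= a)%N ->
  \sum_(y | pi ^+ c * y == 0) amp nu y <= K c * residue_norm nu.
Proof.
move=> ca; set b := residue_norm nu; have b0 : 0 < b by exact: residue_norm_gt0.
(* Cauchy-Schwarz as a weighted mean inequality; with the weight [b] both halves contribute the same
   bound. *)
have AMGM x : x <= (x ^+ 2 / b + b) / 2.
  rewrite -subr_ge0; have -> : (x ^+ 2 / b + b) / 2 - x = (x - b) ^+ 2 / b / 2.
    by field; rewrite gt_eqF.
  by rewrite !divr_ge0 ?sqr_ge0 // ltW.
apply: (le_trans (ler_sum _ (fun y _ => AMGM (amp nu y)))).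
rewrite -mulr_suml big_split /= -mulr_suml ler_pdivrMr // -mulrA mulr_natr mulr2n mulrDr.
apply: lerD.
  by rewrite ler_pdivrMr // -mulrA -expr2 sum_amplitude_sqr_le.
by rewrite sumr_const mulr_natl cardsE.
Qed.

(** A norm below 1 gives two points of the support with distinct residues; their difference is not
    killed by any nonzero [y]. *)
Lemma amplitude_gap nu : residue_norm nu < 1 ->
  exists rho : R, 0 <= rho < 1 /\ forall y, y != 0 -> amp nu y <= rho.
Proof.
move=> b1; exists (\big[Num.max/0]_(y | y != 0) amp nu y).
have [x [x' [nux nux' xx']]] :
    exists x x', [/\ nu x != 0, nu x' != 0 & ~~ residue0 (x - x')].
  apply/not_existsP => H; move: b1; rewrite ltNge => /negP; apply.
  rewrite -sqrtr1 ler_wsqrtr // -(collision1 nu) ler_sum // => x _.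
  rewrite ler_sum // => x' _.
  have [->|nux] := eqVneq (nu x) 0; first by rewrite !mul0r.
  have [->|nux'] := eqVneq (nu x') 0; first by rewrite mulr0 !mul0r.
  suff -> : residue0 (x - x') by [].
  by apply/negPn/negP => xx'; apply: (H x); exists x'.
split; last by move=> y y0; exact: le_bigmax_cond.
apply/andP; split; first exact: bigmax_ge_id.
apply: bigmax_lt => // y y0; apply: (amplitude_lt1 psiD psi_norm nux nux') => //.
by apply/eqP => /(mul_eq0_residue0 y0); exact/negP.
Qed.

(** * Orthogonality and weight of frequency vectors over the chain ring *)

Section Vectors.
Variable I : finType.
Local Notation vec := {ffun I -> A}.
Implicit Types (w : vec) (nu : fdist R A).

(** Fix all coordinates but one, [i], where [w i != 0]. Two solutions for that coordinate have the
    same residue, so the squared conditional probability is at most the collision probability. *)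
Lemma orth_prob_le_norm nu w : w != 0 -> orth_prob nu w <= residue_norm nu.
Proof.
move=> w0; have [i wi] : exists i, w i != 0.
  apply/existsP; rewrite -negb_forall; apply: contra w0 => /forallP H.
  by apply/eqP/ffunP => i; rewrite ffunE; apply/eqP.
rewrite /orth_prob.
under eq_bigr => v _ do rewrite /= /iid_pmf (bigD1 i) //= mulrAC mulrC.
rewrite (sum_resample (fun=> pmf nu) i
  (fun v => nu (v i) * (dot w v == 0)%:R) (pmf_sum1 nu)).
have dotU (v : vec) x :
    dot w (update v i x) = w i * x + \sum_(l | l != i) w l * v l.
  rewrite /dot (bigD1 i) //= ffunE eqxx; congr (_ + _).
  by apply: eq_bigr => l /negbTE li; rewrite ffunE li.
have inner (v : vec) : \sum_x nu (update v i x i) * (dot w (update v i x) == 0)%:R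
    <= residue_norm nu.
  set S := \sum_x _.
  have S0 : 0 <= S by apply: sumr_ge0 => x _; rewrite mulr_ge0 ?pmf_ge0.
  rewrite -(ler_pXn2r (n := 2)) ?nnegrE ?residue_norm_ge0 // residue_norm_sqr expr2.
  rewrite /S big_distrlr /= ler_sum // => x _; rewrite ler_sum // => x' _.
  rewrite !ffunE eqxx mulrACA ler_wpM2l ?mulr_ge0 ?pmf_ge0 // -natrM mulnb ler_nat.
  case: andP => // -[/eqP E /eqP E']; rewrite (mul_eq0_residue0 wi) //.
  transitivity (dot w (update v i x) - dot w (update v i x')); last by rewrite E E' subrr.
  by rewrite !dotU mulrBr opprD addrACA subrr addr0.
apply: (@le_trans _ _ (\sum_(v : vec) iid I nu v * residue_norm nu)); last first.
  by rewrite -mulr_suml pmf_sum1 mul1r.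
apply: ler_sum => v _; rewrite [X in _ <= X * _]/= /iid_pmf [X in _ <= X * _](bigD1 i) //=.
rewrite [nu (v i) * _]mulrC ler_wpM2l // mulr_ge0 ?pmf_ge0 // prodr_ge0 // => l _.
exact: pmf_ge0.
Qed.

Lemma orth_prob_le1 nu w : orth_prob nu w <= 1.
Proof.
rewrite -(pmf_sum1 (iid I nu)) ler_sum // => v _.
by rewrite ler_piMr ?pmf_ge0 // lern1 leq_b1.
Qed.

Definition weight w : nat := #|[set i | w i != 0]|.

Lemma prod_amplitude_le nu w (rho : R) : 0 <= rho ->
  (forall y, y != 0 -> amp nu y <= rho) -> \prod_i amp nu (w i) <= rho ^+ weight w.
Proof.
move=> rho0 H; rewrite /weight -prodr_const big_mkcond [leRHS]big_mkcond /=.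
apply: ler_prod => i _; rewrite amplitude_ge0 inE.
by case: ifP => [/H //|_]; exact: amplitude_le1.
Qed.

Definition sparse (D : nat) w : bool := (D * weight w < #|I|)%N.

(* c is the least power of pi making w sparse; then t w is sparse exactly when
   t lies in the ideal generated by pi^c. *)
Lemma orth_prob_le_class nu w (b rho tau : R) (D m c : nat) :
  residue_norm nu <= b -> 0 <= rho <= 1 -> (forall y, y != 0 -> amp nu y <= rho) ->
  rho ^+ m <= tau -> (D * m <= #|I|)%N -> (0 < D)%N ->
  (forall e, (e < c)%N -> ~~ sparse D (scale_vec (pi ^+ e) w)) ->
  orth_prob nu w <= (K c)^-1 *
    ((if scale_vec (pi ^+ c) w == 0 then 1 else b) + #|A|%:R * tau).
Proof.
move=> nub /andP[rho0 rho1] nurho rhotau DmI D0 Hc.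
have tau0 : 0 <= tau by rewrite (le_trans _ rhotau) // exprn_ge0.
have psi_nd := psi_nondeg.
rewrite (le_trans (orth_prob_le psiD psi_norm psi_nd (r := pi ^+ c) tau0 _)) //.
  (* If [c <= e], then [t] lies in the ideal of [pi ^+ c]. Otherwise [t w] has the weight of
     [pi ^+ e w], which is not sparse, so at least [m] factors are at most [rho]. *)
  move=> t; have [e [u [ea uU ->]]] := chain t.
  have [ce|ec] := leqP c e.
    left; apply/existsP; exists (u * pi ^+ (e - c)).
    by rewrite mulrCA -exprD subnKC.
  right; have := Hc e ec; rewrite /sparse -leqNgt => De.
  under eq_bigr do rewrite -[_ * _](ffunE (fun i => u * pi ^+ e * w i)).
  rewrite (le_trans (prod_amplitude_le _ rho0 nurho)) //.
  rewrite (le_trans _ rhotau) // ler_wiXn2l //.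
  have -> : weight [ffun i => u * pi ^+ e * w i] = weight (scale_vec (pi ^+ e) w).
    apply: eq_card => i; rewrite !inE !ffunE -mulrA mulrI_eq0 //; exact/mulrI.
  by rewrite -(leq_pmul2l D0) (leq_trans DmI).
rewrite mulrDr lerD //.
  rewrite ler_wpM2l ?invr_ge0 //; case: ifPn => [_|w0]; first exact: orth_prob_le1.
  exact: le_trans (orth_prob_le_norm nu w0) nub.
rewrite mulrA ler_peMl // mulrC ler_pdivlMr ?annihilator_gt0 // mul1r ler_nat.
exact: max_card.
Qed.

End Vectors.

(** * Summation over all frequencies and choice of the constants *)

Local Notation q := (#|A|%:R : R).
Local Notation rnorm := residue_norm.

Lemma sum_prod_amplitude_annihilated (I : finType) (nu : fdist R A) r :
  \sum_(w : {ffun I -> A} | scale_vec r w == 0) \prod_i amp nu (w i) =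
  (\sum_(y | r * y == 0) amp nu y) ^+ #|I|.
Proof.
rewrite -prodr_const (bigA_distr_big (fun y => r * y == 0)).
apply: eq_bigl => w; apply/eqP/ffun_onP => [w0 i|H].
  by have /ffunP/(_ i) := w0; rewrite unfold_in !ffunE => ->.
by apply/ffunP => i; have := H i; rewrite unfold_in !ffunE => /eqP.
Qed.

(* Chernoff's method, with theta ^+ D as the cost of a nonzero entry. *)
Lemma card_sparse_le (I : finType) (D : nat) (theta : R) c : 0 < theta <= 1 ->
  \sum_(w : {ffun I -> A}) (sparse D (scale_vec (pi ^+ c) w))%:R <=
  (K c * (theta^-1 * (1 + q * theta ^+ D))) ^+ #|I|.
Proof.
move=> /andP[t0 t1]; set r := pi ^+ c.
rewrite mulrCA exprMn exprVn ler_pdivlMl ?exprn_gt0 // mulr_sumr.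
have k0 : 0 < K c := annihilator_gt0 c.
(* For a sparse vector, [theta ^+ #|I|] is at most [theta ^+ (D * weight)], a product over the
   entries, so that its sum over all vectors factors. *)
apply: (@le_trans _ _ (\sum_(w : {ffun I -> A})
    \prod_i (if r * w i == 0 then 1 else theta ^+ D))).
  apply: ler_sum => w _.
  have -> : \prod_i (if r * w i == 0 then 1 else theta ^+ D) =
      theta ^+ (D * weight (scale_vec r w)).
    rewrite exprM /weight -prodr_const [RHS]big_mkcond; apply: eq_bigr => i _.
    by rewrite inE ffunE; case: eqP.
  have [|_] := boolP (sparse D (scale_vec r w)).
    by rewrite /sparse => /ltnW H; rewrite mulr1 ler_wiXn2l // ltW.
  by rewrite mulr0 exprn_ge0 // ltW.
rewrite -(bigA_distr_bigA (fun (_ : I) y => if r * y == 0 then 1 else theta ^+ D)).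
rewrite prodr_const lerXn2r ?nnegrE //.
- by apply: sumr_ge0 => y _; case: ifP => // _; rewrite exprn_ge0 // ltW.
- by rewrite mulr_ge0 // ?addr_ge0 // ?mulr_ge0 // ?exprn_ge0 // ltW.
rewrite (bigID (fun y => r * y == 0)) /= mulrDr mulr1 lerD //.
  under eq_bigr => y -> do []; rewrite sumr_const /annihilator cardsE //.
rewrite (le_trans (y := q * theta ^+ D)) //.
  rewrite mulr_natl -sumr_const big_mkcond ler_sum // => y _.
  by case: ifPn => [/negbTE -> //|_]; rewrite exprn_ge0 // ltW.
by rewrite ler_peMl ?mulr_ge0 ?exprn_ge0 ?(ltW t0) // ler1n -(ltr0n R).
Qed.

(** Each [w] is charged to the least [c] making [pi ^+ c w] sparse, whence the factor [a.+1]. If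
    [pi ^+ c w] is zero, the amplitudes are summed by Cauchy-Schwarz; otherwise they are bounded by
    1, the sparse vectors are counted, and the orthogonality probability supplies [rnorm xi]. *)
Lemma column_sum_le n (j : 'I_n) (xi : fdist R A) (nu : 'I_n -> fdist R A)
    (rho tau theta : R) (D m : nat) :
  (forall l, rnorm (nu l) <= rnorm xi) -> 0 <= rho <= 1 ->
  (forall l y, y != 0 -> amp (nu l) y <= rho) ->
  rho ^+ m <= tau -> (D * m <= n)%N -> (0 < D)%N -> 0 < theta <= 1 ->
  \sum_(w : {ffun 'I_n -> A} | w != 0) (\prod_i amp xi (w i)) *
     \prod_(l | l != j) orth_prob (nu l) w <=
  q / rnorm xi * (a.+1%:R *
     ((rnorm xi * (1 + q * tau)) ^+ n +
      (theta^-1 * (1 + q * theta ^+ D) * (rnorm xi + q * tau)) ^+ n)).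
Proof.
move=> nub rho01 nurho rhotau DmI D0 theta01.
set b := rnorm xi; set eta := q * tau.
have b0 : 0 < b by exact: residue_norm_gt0.
have b1 : b <= 1 by exact: residue_norm_le1.
have tau0 : 0 <= tau by rewrite (le_trans _ rhotau) // exprn_ge0 //; case/andP: rho01.
have eta0 : 0 <= eta by rewrite mulr_ge0.
have q0 : 0 < q by rewrite ltr0n card_ring_gt0.
have k0 c : 0 < K c := annihilator_gt0 c.
pose F (w : {ffun 'I_n -> A}) := \prod_i amp xi (w i).
have F0 w : 0 <= F w by apply: prodr_ge0 => i _; exact: amplitude_ge0.
have F1 w : F w <= 1.
  by apply: prodr_ile1 => i _; rewrite amplitude_ge0 amplitude_le1.
pose T (c : nat) w : R := (K c)^-1 ^+ n *
  (((0 < c)%N && (scale_vec (pi ^+ c) w == 0))%:R * F w * (1 + eta) ^+ n +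
   (sparse D (scale_vec (pi ^+ c) w))%:R * (b + eta) ^+ n).
have T0 c w : 0 <= T c w.
  rewrite mulr_ge0 ?exprn_ge0 ?invr_ge0 // addr_ge0 // ?mulr_ge0 //.
    by rewrite exprn_ge0 // addr_ge0.
  by rewrite exprn_ge0 // addr_ge0 // ltW.
apply: (@le_trans _ _ (\sum_w q / b * \sum_(c < a.+1) T c w)).
  rewrite big_mkcond; apply: ler_sum => w _; case: ifPn => [w0|_]; last first.
    rewrite mulr_ge0 ?divr_ge0 ?(ltW b0) //; apply: sumr_ge0 => c _; exact: T0.
  (* The exponent [a] always qualifies, because [pi ^+ a = 0] and, as [j] exists, [n] is
     positive. *)
  have spa : sparse D (scale_vec (pi ^+ a) w).
    rewrite /sparse (_ : weight _ = 0%N) ?muln0 ?card_ord ?(leq_ltn_trans _ (ltn_ord j)) //.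
    by apply: eq_card0 => i; rewrite inE ffunE pi_a mul0r eqxx.
  have ex : exists c, sparse D (scale_vec (pi ^+ c) w) by exists a.
  have [c csp cmin] := ex_minnP ex.
  have ca : (c < a.+1)%N by rewrite ltnS cmin.
  pose x := if scale_vec (pi ^+ c) w == 0 then 1 else b.
  pose B := (K c)^-1 * (x + eta).
  have bx : b <= x by rewrite /x; case: ifP.
  have x0 : 0 <= x by rewrite (le_trans (ltW b0)).
  (* The product runs over [n - 1] columns only; this lower bound completes it to [B ^+ n] at the
     cost of [q / b]. *)
  have Bge : b / q <= B.
    rewrite mulrC /B ler_pM ?invr_ge0 ?(ltW b0) //.
      by rewrite lef_pV2 ?posrE // ler_nat max_card.
    by rewrite (le_trans bx) // lerDl.
  have B0 : 0 <= B by rewrite (le_trans _ Bge) // divr_ge0 // ltW.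
  have PB l : 0 <= orth_prob (nu l) w <= B.
    rewrite orth_prob_ge0 /=.
    apply: (orth_prob_le_class (nub l) rho01
      (nurho l) rhotau _ D0); first by rewrite card_ord.
    by move=> e ec; apply/negP => /cmin; rewrite leqNgt ec.
  apply: (@le_trans _ _ (q / b * T c w)); last first.
    rewrite ler_wpM2l ?divr_ge0 ?(ltW b0) // (bigD1 (Ordinal ca)) //= lerDl.
    by apply: sumr_ge0 => c' _; exact: T0.
  apply: (@le_trans _ _ (q / b * (F w * B ^+ n))).
    rewrite [leRHS]mulrCA; apply: ler_wpM2l; first exact: F0.
    apply: (@le_trans _ _ (\prod_(l < n | l != j) B)); first by apply: ler_prod.
    rewrite -[n in B ^+ n]card_ord -prodr_const [in leRHS](bigD1 j) //= mulrA.
    rewrite ler_peMl ?prodr_ge0 //.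
    by rewrite -ler_pdivrMl ?divr_gt0 // invf_div mulr1.
  rewrite ler_wpM2l ?divr_ge0 ?(ltW b0) //.
  rewrite /B exprMn mulrCA /T ler_wpM2l ?exprn_ge0 ?invr_ge0 //.
  rewrite csp mul1r /x; case: eqP => [w0c|_].
    have c0 : (0 < c)%N.
      rewrite lt0n; apply: contraNneq w0 => c0; apply/eqP/ffunP => i.
      by have /ffunP/(_ i) := w0c; rewrite c0 expr0 !ffunE mul1r.
    by rewrite c0 mul1r lerDl exprn_ge0 // addr_ge0 // ltW.
  by rewrite andbF !mul0r add0r -[leRHS]mul1r ler_wpM2r // exprn_ge0 // addr_ge0 // ltW.
rewrite -mulr_sumr ler_wpM2l ?divr_ge0 ?(ltW b0) //.
rewrite exchange_big -[X in X%:R * _]card_ord mulr_natl -sumr_const ler_sum // => c _.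
rewrite -mulr_sumr big_split /= -!mulr_suml mulrDr lerD //.
  have [c0|c0] : c = 0%N :> nat \/ (0 < c)%N by case: (posnP c); [left | right].
    rewrite big1 ?mul0r ?mulr0 // => [|w _]; last by rewrite c0 mul0r.
    by rewrite exprn_ge0 // mulr_ge0 ?(ltW b0) // addr_ge0.
  have -> : \sum_w ((0 < c)%N && (scale_vec (pi ^+ c) w == 0))%:R * F w =
      (\sum_(y | pi ^+ c * y == 0) amp xi y) ^+ n.
    rewrite -[n in RHS]card_ord -sum_prod_amplitude_annihilated [RHS]big_mkcond.
    by apply: eq_bigr => w _; rewrite c0; case: ifP => _; rewrite ?mul1r ?mul0r.
  rewrite mulrA -!exprMn lerXn2r ?nnegrE //.
  - rewrite !mulr_ge0 ?invr_ge0 ?addr_ge0 //.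
    by apply: sumr_ge0 => y _; exact: amplitude_ge0.
  - by rewrite mulr_ge0 ?(ltW b0) // addr_ge0.
  rewrite ler_wpM2r ?addr_ge0 // ler_pdivrMl //.
  apply: sum_amplitude_le.
  by rewrite c0 -ltnS ltn_ord.
rewrite mulrA [leRHS]exprMn ler_wpM2r ?exprn_ge0 ?addr_ge0 ?(ltW b0) //.
rewrite exprVn ler_pdivrMl ?exprn_gt0 // -exprMn.
have := card_sparse_le 'I_n D c theta01; rewrite card_ord; exact.
Qed.

(** With [e = eps / 4] and [E = expR e], both terms of the column bound are made at most
    [(b * E ^+ 3) ^+ n]; a fourth factor [E ^+ n] pays for the number [n] of columns. *)
Lemma iid_mx_mixing (xi nu : fdist R A) (eps : R) : 0 < eps ->
  (forall y, y != 0 -> fourier psi nu y = 0) ->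
  exists2 C : R, 0 <= C & forall n (phi : 'M[A]_n -> R),
    (forall M, 0 <= phi M <= 1) -> SL_right_invariant phi ->
    `|\sum_M iid_mx n n xi M * phi M - \sum_M iid_mx n n nu M * phi M| <=
    C * expR (eps * n%:R) * rnorm xi ^+ n.
Proof.
move=> eps0 nu0; set b := rnorm xi.
have E1 n : 1 <= expR (eps * n%:R) by rewrite -[leLHS]expR0 ler_expR mulr_ge0 // ltW.
have [b1|b1] := leP 1 b.
  exists 1 => // n phi phi01 _; rewrite (le_trans (mean_diff_le1 _ _ phi01)) //.
  rewrite mul1r -[leLHS]mulr1 ler_pM //; exact: exprn_ege1.
have b0 : 0 < b by exact: residue_norm_gt0.
have q0 : 0 < q by rewrite ltr0n card_ring_gt0.
have [rho [/andP[rho0 rho1] xirho]] := amplitude_gap b1.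
pose e := eps / 4; have e0 : 0 < e by rewrite divr_gt0.
pose theta := expR (- e); have theta0 : 0 < theta by exact: expR_gt0.
have theta1 : theta < 1 by rewrite expR_lt1 oppr_lt0.
have [d dP] : exists d, theta ^+ d <= e / q.
  by apply: exists_expr_le; [rewrite (ltW theta0) | exact: divr_gt0].
(* With [tau = e * b / q], the error [q * tau] is small relative to [b] and not only to 1. *)
have [m mP] : exists m, rho ^+ m <= e * b / q.
  by apply: exists_expr_le; [rewrite rho0 | exact: divr_gt0 (mulr_gt0 e0 b0) q0].
pose D := d.+1; pose C := q / b * (a.+1%:R * 2) / e.
have C0 : 0 <= C by rewrite !mulr_ge0 ?invr_ge0 // ltW.
exists (C + b ^- (D * m)); first by rewrite addr_ge0 // invr_ge0 exprn_ge0 // ltW.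
move=> n phi phi01 phiSL.
(* Dimensions too small for the weight threshold are covered by the trivial bound 1 and the constant
   [b ^- (D * m)]. *)
have [nDm|Dmn] := ltnP n (D * m).
  rewrite (le_trans (mean_diff_le1 _ _ phi01)) //.
  apply: (@le_trans _ _ (b ^- (D * m) * expR (eps * n%:R) * b ^+ n)).
    rewrite mulrAC -[leLHS]mulr1 ler_pM // mulrC ler_pdivlMr ?exprn_gt0 // mul1r.
    by rewrite ler_wiXn2l ?(ltW b0) ?(ltW b1) // ltnW.
  by rewrite ler_wpM2r ?exprn_ge0 ?(ltW b0) // ler_wpM2r ?expR_ge0 // lerDr.
pose E := expR e; have EP : 1 + e <= E by exact: expR_ge1Dx.
have Epos : 0 < E by exact: expR_gt0.
have E1' : 1 <= E by rewrite -[leLHS]expR0 ler_expR ltW.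
apply: (@le_trans _ _ (C * expR (eps * n%:R) * b ^+ n)); last first.
  rewrite ler_wpM2r ?exprn_ge0 ?(ltW b0) // ler_wpM2r ?expR_ge0 // lerDl.
  by rewrite invr_ge0 exprn_ge0 // ltW.
have psi_nd := psi_nondeg.
rewrite (le_trans (iid_mx_diff psiD psi_norm psi_nd xi nu0 phi01 phiSL)) //.
have thetaV : theta^-1 = E by rewrite /theta expRN invrK.
have col (j : 'I_n) := column_sum_le (n := n) j
  (xi := xi) (nu := fun l : 'I_n => if (l < j)%N then nu else xi) (rho := rho)
  (tau := e * b / q) (theta := theta) (D := D) (m := m).
have {}col (j : 'I_n) : \sum_(w : {ffun 'I_n -> A} | w != 0)
   (\prod_i amplitude psi xi (w i)) *
   \prod_(l < n | l != j) orth_prob (if (l < j)%N then nu else xi) w <=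
   q / b * (a.+1%:R * (2 * (b * E ^+ 3) ^+ n)).
  apply: (le_trans (col j _ _ _ _ _ _ _)) => //.
  - move=> l; case: ifP => // _.
    exact: residue_norm_min.
  - by rewrite rho0 ltW.
  - move=> l y y0; case: ifP => _; last exact: xirho.
    by rewrite /amplitude nu0 // normr0.
  - by rewrite theta0 ltW.
  rewrite ler_wpM2l ?divr_ge0 ?(ltW b0) // ler_wpM2l // [leRHS]mulr_natl mulr2n.
  have -> : q * (e * b / q) = e * b by rewrite mulrC divfK // gt_eqF.
  have eb : 0 <= e * b by rewrite mulr_ge0 // ltW.
  have ebe : e * b <= e by rewrite ler_piMr ?(ltW b1) ?(ltW e0).
  have bw := ltW b0; have ew := ltW e0; have Ew := ltW Epos; have thetaw := ltW theta0.
  have bE : 0 <= b * E ^+ 3 by rewrite mulr_ge0 ?exprn_ge0.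
  have th0 : 0 <= 1 + q * theta ^+ D.
    by rewrite addr_ge0 // mulr_ge0 // exprn_ge0.
  have beb : 0 <= b + e * b by rewrite addr_ge0.
  apply: lerD; apply: lerXn2r; rewrite ?nnegrE //.
  - by rewrite mulr_ge0 // addr_ge0.
  - rewrite ler_wpM2l // (le_trans (y := E)) //.
      by rewrite (le_trans _ EP) // lerD2l.
    by rewrite exprS ler_peMr // exprn_ege1.
  - by apply: mulr_ge0 => //; rewrite thetaV mulr_ge0.
  have thetaE : 1 + q * theta ^+ D <= E.
    rewrite (le_trans _ EP) // lerD2l mulrC -ler_pdivlMr // (le_trans _ dP) //.
    by rewrite exprS ler_piMl ?exprn_ge0 // ltW.
  have bebE : b + e * b <= E * b by rewrite -{1}[b]mul1r -mulrDl ler_wpM2r.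
  have -> : b * E ^+ 3 = E * E * (E * b) by ring.
  rewrite thetaV; apply: ler_pM => //.
  - exact: mulr_ge0.
  by rewrite ler_wpM2l.
apply: (le_trans (ler_sum _ (fun j _ => col j))).
rewrite sumr_const card_ord -[leLHS]mulr_natl.
have nE : n%:R <= e^-1 * E ^+ n.
  rewrite ler_pdivlMl // -expRM_natl mulrC (le_trans _ (expR_ge1Dx _)) //.
  by rewrite lerDr.
have -> : expR (eps * n%:R) = E ^+ n * (E ^+ 3) ^+ n.
  rewrite -exprMn -exprS -exprM -expRM_natl; congr expR.
  by rewrite natrM /e; field.
apply: (@le_trans _ _ (e^-1 * E ^+ n * (q / b * (a.+1%:R * (2 * (b * E ^+ 3) ^+ n))))).
  by rewrite ler_wpM2r // !mulr_ge0 ?invr_ge0 ?exprn_ge0 ?mulr_ge0 ?exprn_ge0 ?ltW.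
rewrite /C exprMn le_eqVlt; apply/orP; left; apply/eqP; ring.
Qed.

End ChainRing.

(** * The ring Z/p^a *)

Section PrimePower.
Local Open Scope complex_scope.
Variables (R : realType) (p a : nat).
Hypotheses (p_prime : prime p) (a_gt0 : (0 < a)%N).
Local Notation q := (p ^ a)%N.
Local Notation A := 'Z_q.

Lemma prime_power_gt1 : (1 < q)%N.
Proof. by rewrite -(exp1n a) ltn_exp2r // prime_gt1. Qed.

Lemma natZ_eq0 n m : (1 < m)%N -> (n%:R == 0 :> 'Z_m) = (m %| n)%N.
Proof.
by move=> m1; rewrite -(inj_eq val_inj) /= val_Zp_nat.
Qed.

Lemma val_ZpD m (x y : 'Z_m) : (1 < m)%N -> nat_of_ord (x + y) = ((x + y)%N %% m)%N.
Proof. by move=> m1; congr (_ %% _)%N; exact: Zp_cast. Qed.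

Lemma exists_prim_root (C : numClosedFieldType) n : (0 < n)%N ->
  exists z : C, n.-primitive_root z.
Proof.
move=> n0; have [r def_r] := closed_field_poly_normal ('X^n - 1 : {poly C}).
rewrite (monicP (monicXnsubC 1 n0)) scale1r in def_r.
have /hasP[z _ prim_z] : has n.-primitive_root r; last by exists z.
apply: has_prim_root => //.
- by apply/allP => z rz; rewrite -root_prod_XsubC -def_r in rz.
- by rewrite -separable_prod_XsubC -def_r separable_Xn_sub_1 // pnatr_eq0 -lt0n.
by rewrite -ltnS -(size_prod_XsubC r id) -def_r size_XnsubC.
Qed.

(** The character is [z ^+ x] for a primitive root of unity [z] of order [p ^ a]; primitivity makes
    it faithful. *)
Lemma exists_Zp_character : exists psi : A -> R[i],
  [/\ forall x y, psi (x + y) = psi x * psi y, forall x, `|psi x| = 1 &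
      forall z, z != 0 -> psi z != 1].
Proof.
have q1 := prime_power_gt1; have q0 : (0 < q)%N by exact: ltnW.
have [z prim_z] := exists_prim_root R[i] q0.
exists (fun x : A => z ^+ x); split=> [x y|x|x x0].
- by rewrite -exprD val_ZpD // prim_expr_mod.
- have : `|z| ^+ q = 1 by rewrite -normrX prim_expr_order ?normr1.
  move/eqP; rewrite pexpr_eq1 // => /eqP z1.
  by rewrite normrX z1 expr1n.
rewrite -(prim_order_dvd prim_z); apply: contra x0 => xq.
by rewrite -(natr_Zp x) natZ_eq0.
Qed.

Lemma pX_eq0 e : (p%:R ^+ e == 0 :> A) = (a <= e)%N.
Proof.
by rewrite -natrX natZ_eq0 ?prime_power_gt1 // dvdn_Pexp2l // prime_gt1.
Qed.

(** The exponent is the [p]-adic valuation of the representative of [t], with [a] for [t = 0]. *)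
Lemma Zp_chain (t : A) :
  exists e u, [/\ (e <= a)%N, u \is a GRing.unit & t = u * p%:R ^+ e].
Proof.
have q1 := prime_power_gt1.
have [->|t0] := eqVneq t 0.
  exists a, 1; split; rewrite ?unitr1 // mul1r.
  by apply/esym/eqP; rewrite pX_eq0.
have t0' : (0 < t)%N by rewrite lt0n; apply: contraNneq t0 => t0; apply/eqP/val_inj.
have [m pm def_t] := pfactor_coprime p_prime t0'.
exists (logn p t), m%:R; split.
- rewrite -(@leq_exp2l p) ?prime_gt1 // (leq_trans (n := t)) //.
    by rewrite dvdn_leq // pfactor_dvdnn.
  by rewrite ltnW // -[X in (_ < X)%N]Zp_cast.
- by rewrite unitZpE // coprimeXl.
by rewrite -{1}(natr_Zp t) {1}def_t natrM natrX.
Qed.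

(** [p ^ a] divides [p ^ a.-1 * z] exactly when [p] divides [z], and reduction modulo [p] is
    additive because [p] divides [p ^ a]. *)
Lemma residue0_Zp (x y : A) :
  residue0 p%:R a (x - y) = ((x : nat)%:R == (y : nat)%:R :> 'Z_p).
Proof.
have q1 := prime_power_gt1; have p1 := prime_gt1 p_prime.
set z := x - y; have def_x : x = y + z by rewrite addrC subrK.
rewrite /residue0 -(natr_Zp z) -natrX -natrM natZ_eq0 //.
rewrite -{1}(prednK a_gt0) expnSr dvdn_pmul2l ?expn_gt0 ?prime_gt0 //.
have -> : (x : nat)%:R = (y : nat)%:R + (z : nat)%:R :> 'Z_p.
  rewrite -natrD {1}def_x val_ZpD // -(Zp_nat_mod p1) modn_dvdm ?Zp_nat_mod //.
  exact: dvdn_exp.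
by rewrite addrC -subr_eq0 addrK natZ_eq0.
Qed.

(** Expanding the squares into pairs of samples, a pair is counted once if its residues agree and
    not at all otherwise. *)
Lemma l2norm_mod_residue_norm (xi : fdist R A) :
  l2norm_mod p xi = residue_norm p%:R a xi.
Proof.
congr Num.sqrt; rewrite /collision /prob.
under eq_bigr => x _ do rewrite big_mkcond expr2 big_distrlr /=.
rewrite exchange_big; apply: eq_bigr => y _.
rewrite exchange_big; apply: eq_bigr => y' _.
rewrite residue0_Zp (bigD1 ((y : nat)%:R : 'Z_p)) //= big1 ?addr0 => [|x xy]; last first.
  by case: asboolP => [/= yx|_]; rewrite ?mul0r // -yx eqxx in xy *.
case: asboolP => //= _; case: asboolP => [/= ->|/= y'y].
  by rewrite eqxx mulr1.
by rewrite mulr0; case: eqP => [yy'|]; rewrite ?mulr0 //; case: y'y.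
Qed.

Definition uniform_entry : fdist R A :=
  uniform R (card_ring_gt0 A).

Lemma uniform_mx_iid N M :
  uniform_mx R A N N M = iid_mx N N uniform_entry M.
Proof.
transitivity (\prod_(i < N) \prod_(j < N) (#|A|%:R : R)^-1); last by [].
rewrite !prodr_const (card_ord N : #|xpredT : pred 'I_N| = N).
by rewrite /= /uniform_pmf card_mx natrX exprM !exprVn.
Qed.

End PrimePower.

(** * The bound for products of matrices over Z/p^a *)

Theorem mainTheorem4 (R : realType) (p a : nat) (p_prime : prime p)
    (a_ge1 : (1 <= a)%N) (xi : fdist R 'Z_(p ^ a))
    (xi_gen : ~ concentrated_on_affine_proper_subring xi)
    (eps : R) (eps_gt0 : 0 < eps) :
  exists C : R, forall N k : nat, (1 <= N)%N -> (1 <= k)%N ->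
    forall (V : Type) (f : 'M['Z_(p ^ a)]_N -> V), SL_right_invariant f ->
      d_TV (iid 'I_k (iid_mx N N xi)) (fun M => f (prod_mx M))
           (iid 'I_k (uniform_mx R 'Z_(p ^ a) N N)) (fun U => f (prod_mx U))
      < k%:R * C * expR (eps * N%:R) * l2norm_mod p xi ^+ N.
Proof.
have [psi [psiD psi_norm psi_inj]] := exists_Zp_character R p_prime a_ge1.
have pi_a : p%:R ^+ a = 0 :> 'Z_(p ^ a) by apply/eqP; rewrite pX_eq0.
have pi_a1 : p%:R ^+ a.-1 != 0 :> 'Z_(p ^ a).
  by rewrite pX_eq0 // -ltnNge prednK.
have chain := Zp_chain p_prime a_ge1.
have nu0 y : y != 0 -> fourier psi (uniform_entry R p a) y = 0.
  move=> y0; rewrite /fourier /= /uniform_pmf -mulr_sumr.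
  under eq_bigr do rewrite mulrC.
  rewrite (sum_psi psiD psi_norm); first by rewrite (negbTE y0) muln0 mulr0.
  exact: (psi_nondeg psi_inj).
have [C C0 CP] := iid_mx_mixing psiD psi_norm psi_inj a_ge1 pi_a pi_a1 chain xi eps_gt0 nu0.
(* The added 1 makes the inequality strict, since [k], the exponential and the norm are positive. *)
exists (C + 1) => N k _ k1 V f fSL; rewrite (l2norm_mod_residue_norm p_prime a_ge1).
set b := residue_norm _ _ _ in CP *.
have b0 : 0 < b by exact: (residue_norm_gt0 psiD psi_norm psi_inj a_ge1 pi_a pi_a1 chain).
apply: (@le_lt_trans _ _ (k%:R * (C * expR (eps * N%:R) * b ^+ N))).
  apply: d_TV_prod_mx_le => // phi phi01 phiSL.
  under [X in `|_ - X|]eq_bigr do rewrite uniform_mx_iid.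
  exact: CP.
rewrite -!mulrA ltr_pM2l ?ltr0n // !mulrA ltr_pM2r ?exprn_gt0 //.
by rewrite ltr_pM2r ?expR_gt0 // ltrDl.
Qed.
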